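(* Let $n\ge1$ be an integer, $a,b\in\mathbb R$ with $a\ne0$, $\lambda\in\mathbb R$, and work on an interval on which $ax+b\neq0$. The operational identity $$\prod_{k=n}^{0}\left(D-k\frac{a}{ax+b}\right)=(ax+b)^{n+1}\left(\frac1{ax+b}D\right)^{n+1}$$ holds, and: (i) if $\lambda\neq0$, the equation $$y_n''-\left(\lambda+\frac{n(n+1)a^2}{(ax+b)^2}\right)y_n=0$$ has general solution $$y_n=(ax+b)^{n+1}\left(\frac1{ax+b}D\right)^{n+1}y_0,$$ where $y_0$ is the general solution of $y_0''-\lambda y_0=0$; (ii) if $\lambda=0$, the operator of the equation factorizes as $$D^2-\frac{n(n+1)a^2}{(ax+b)^2}=\left(D-\frac{na}{ax+b}\right)\left(D+\frac{na}{ax+b}\right)=\left(D+\frac{(n+1)a}{ax+b}\right)\left(D-\frac{(n+1)a}{ax+b}\right),$$ and the equation $y_n''-\frac{n(n+1)a^2}{(ax+b)^2}y_n=0$ has general solution $y=c_1(ax+b)^{n+1}+c_2(ax+b)^{-n}$.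
   Context: $D=d/dx$. A product $\prod_{k=n}^{0}L_k$ denotes the composition $L_nL_{n-1}\cdots L_0$ ($L_0$ applied first); functions act by multiplication, so $\frac1fD$ sends $y$ to $y'/f$. For $\lambda\ne0$ the general solution of $y_0''-\lambda y_0=0$ is $y_0=c_1e^{\sqrt\lambda x}+c_2e^{-\sqrt\lambda x}$, equivalently $c_1\cosh(\sqrt\lambda x)+c_2\sinh(\sqrt\lambda x)$ if $\lambda>0$, or $c_1\cos(\sqrt{-\lambda}x)+c_2\sin(\sqrt{-\lambda}x)$ if $\lambda<0$, with $c_1,c_2$ arbitrary (complex) constants. ''General solution'' means that letting $c_1,c_2$ vary gives exactly all (complex-valued) solutions on the interval. *)

(* Defs.v *)
From Stdlib Require Import Reals.
From Coquelicot Require Import Coquelicot.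

Open Scope R_scope.

(** Nondegenerate intervals of any kind (open, closed, half-open, unbounded). *)
Definition interval (I : R -> Prop) : Prop :=
  is_connected I /\ exists u v : R, I u /\ I v /\ u < v.

(** [is_derive] with the neighbourhood filter restricted to [I]: it is the usual
    derivative at interior points of [I] and the one-sided one at an endpoint
    belonging to [I]. *)
Definition is_derive_on (I : R -> Prop) (f : R -> C) (x : R) (l : C) : Prop :=
  filterdiff (V := C_R_NormedModule) f (within I (locally x))
    (fun h : R => scal (V := C_R_NormedModule) h l).

Definition operator : Type := (R -> C) -> (R -> C).

(** [d/dx] as a total operator; like [Derive] and [RInt], its value is
    meaningful only where the derivative exists. *)
Definition Dop (I : R -> Prop) : operator :=
  fun f x => iota (T := C_R_CompleteNormedModule) (is_derive_on I f x).

(** [f] is [m] times differentiable on [I]. *)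
Definition diff_times (I : R -> Prop) (m : nat) (f : R -> C) : Prop :=
  forall k : nat, (k < m)%nat -> forall x : R, I x ->
    exists l : C, is_derive_on I (Nat.iter k (Dop I) f) x l.

Definition mul_op (g : R -> R) : operator :=
  fun f x => Cmult (RtoC (g x)) (f x).

Definition add_op (A B : operator) : operator :=
  fun f x => Cplus (A f x) (B f x).

Definition sub_op (A B : operator) : operator :=
  fun f x => Cminus (A f x) (B f x).

Definition comp_op (A B : operator) : operator := fun f => A (B f).

Definition pow_op (A : operator) (m : nat) : operator := Nat.iter m A.

(** The product [L n ... L 1 L 0], with [L 0] applied first. *)
Fixpoint prod_op (L : nat -> operator) (n : nat) : operator :=
  match n with
  | O => L O
  | S m => comp_op (L (S m)) (prod_op L m)
  end.

(** Equality on [I] of two differential operators of order at most [m], on their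
    natural domain, the [m] times differentiable functions. *)
Definition eq_op_on (I : R -> Prop) (m : nat) (A B : operator) : Prop :=
  forall f : R -> C, diff_times I m f -> forall x : R, I x -> A f x = B f x.

(** [f] solves on [I] the second-order equation [A f = 0]. *)
Definition solves (I : R -> Prop) (A : operator) (f : R -> C) : Prop :=
  diff_times I 2 f /\ forall x : R, I x -> A f x = RtoC 0.

(** Letting [c1], [c2] vary, [F c1 c2] gives exactly all solutions on [I]. *)
Definition general_solution (I : R -> Prop) (A : operator)
    (F : C -> C -> R -> C) : Prop :=
  forall f : R -> C,
    solves I A f <->
    exists c1 c2 : C, forall x : R, I x -> f x = F c1 c2 x.

Definition lin_comb (u v : R -> C) (c1 c2 : C) : R -> C :=
  fun x => Cplus (Cmult c1 (u x)) (Cmult c2 (v x)).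

Definition Cexp (z : C) : C := (exp (fst z) * cos (snd z), exp (fst z) * sin (snd z)).

(** The complex square root of a real number, [i sqrt (- l)] when [l < 0];
    recall that the real [sqrt] is [0] on negative numbers. *)
Definition Csqrt_real (l : R) : C := (sqrt l, sqrt (- l)).

(* Main.v *)
Require Import Defs.
From Stdlib Require Import Reals Lra Lia.
From Coquelicot Require Import Coquelicot.

(** Write [s = a / (a x + b)], so that [s' = - s^2], and [A k = D - k s].  Then

      A k (A (-k)) = D^2 - k (k + 1) s^2,    A (-k) (A k) = D^2 - k (k - 1) s^2.

    These are the two factorizations at [lam = 0] (take [k = n] and
    [k = - (n + 1)]).  They also make [A k] intertwine consecutive equations:
    it maps solutions of [y'' = (lam + k (k - 1) s^2) y] to solutions of
    [y'' = (lam + k (k + 1) s^2) y], and [A (-k)] maps the latter back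
    ([darboux_transform]).  On solutions the composition of the two is
    multiplication by [lam], so for [lam <> 0] each [A k] is onto
    ([raising_onto]) and no dimension count is needed.  Starting from
    [y'' = lam y], with [A 0 = D] as first step, the product [A n ... A 1 A 0]
    therefore maps the solutions of [y0'' = lam y0] onto those of the equation
    for [y_n] ([general_solution_ladder]).

    The operational identity follows by induction on the number of factors,
    because [A (m + 1)] kills [(a x + b)^(m + 1)]:
    [A (m + 1) ((a x + b)^(m + 1) g) = (a x + b)^(m + 1) g'].

    The remaining equations have explicit pairs of solutions.  Wronskians of two
    solutions are constant on an interval, and by Cramer's rule every solution
    is a combination, with Wronskians as coefficients, of two solutions whose
    own Wronskian does not vanish ([general_solution_wronskian]). *)

(** * Differentiation relative to an interval *)

Definition deriv_on (I : R -> Prop) (f g : R -> C) : Prop :=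
  forall x : R, I x -> is_derive_on I f x (g x).

Lemma within_locally_proper (I : R -> Prop) (x : R) :
  I x -> ProperFilter (within I (locally x)).
Proof.
intros Ix. split.
- intros P HP. exists x. exact (locally_singleton _ _ HP Ix).
- apply within_filter, locally_filter.
Qed.

Lemma within_locally_lim (I : R -> Prop) (x : R) :
  is_filter_lim (within I (locally x)) x.
Proof.
intros P HP. unfold within. revert HP.
apply filter_imp. intros y Py _; exact Py.
Qed.

Lemma Cmod_norm_R (z : C) : norm (V := C_R_NormedModule) z = Cmod z.
Proof.
change (sqrt (Rabs (fst z) ^ 2 + Rabs (snd z) ^ 2) = sqrt (fst z ^ 2 + snd z ^ 2)).
now rewrite !pow2_abs.
Qed.

(** All the calculus below rests on this form: the filter definition quantifies
    over every limit point of the restricted filter, but for [x] in [I] there is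
    only [x] itself. *)
Lemma is_derive_on_Cmod (I : R -> Prop) (f : R -> C) (x : R) (l : C) :
  I x ->
  (is_derive_on I f x l <->
   forall eps : posreal, exists delta : posreal, forall y : R, I y ->
     Rabs (y - x) < delta ->
     Cmod (f y - f x - RtoC (y - x) * l)%C <= eps * Rabs (y - x)).
Proof.
intros Ix.
assert (E : forall y, norm (V := C_R_NormedModule)
  (minus (G := C_R_NormedModule) (minus (G := C_R_NormedModule) (f y) (f x))
    (scal (V := C_R_NormedModule) (minus y x) l)) = Cmod (f y - f x - RtoC (y - x) * l)%C).
{ intros y. rewrite scal_R_Cmult. exact (Cmod_norm_R _). }
split.
- intros [_ H] eps.
  destruct (H x (within_locally_lim I x) eps) as [d Hd].
  exists d. intros y Iy Hy.
  rewrite <- E. exact (Hd y Hy Iy).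
- intros H. split.
  + apply is_linear_scal_l.
  + intros z Hz.
    assert (z = x) as ->.
    { pose proof (within_locally_proper I x Ix) as Hp.
      exact (is_filter_lim_unique (V := R_NormedModule) z x Hz (within_locally_lim I x)). }
    intros eps. destruct (H eps) as [d Hd].
    exists d. intros y Hy Iy.
    pose proof (Hd y Iy Hy) as Hb. rewrite <- E in Hb. exact Hb.
Qed.

Lemma is_derive_on_ext (I : R -> Prop) (f g : R -> C) (x : R) (l : C) :
  I x -> (forall y : R, I y -> f y = g y) ->
  is_derive_on I f x l -> is_derive_on I g x l.
Proof.
intros Ix E. rewrite !is_derive_on_Cmod by assumption.
intros H eps. destruct (H eps) as [d Hd]. exists d. intros y Iy.
rewrite <- !E by assumption. exact (Hd y Iy).
Qed.

Lemma interval_limit_point (I : R -> Prop) (x d : R) :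
  interval I -> I x -> 0 < d -> exists y : R, I y /\ y <> x /\ Rabs (y - x) < d.
Proof.
intros [Hc (u & v & Iu & Iv & uv)] Ix Hd.
destruct (Rlt_dec x v) as [xv | xv].
- exists (Rmin v (x + d / 2)).
  unfold Rmin; destruct (Rle_dec v (x + d / 2)).
  + repeat split; [assumption | lra | apply Rabs_def1; lra].
  + repeat split; [apply (Hc x v); [assumption .. | lra] | lra | apply Rabs_def1; lra].
- exists (Rmax u (x - d / 2)).
  unfold Rmax; destruct (Rle_dec u (x - d / 2)).
  + repeat split; [apply (Hc u x); [assumption .. | lra] | lra | apply Rabs_def1; lra].
  + repeat split; [assumption | lra | apply Rabs_def1; lra].
Qed.

(** Nondegeneracy of the interval is essential: the two linearisations have to
    be compared at points of [I] other than [x], arbitrarily close to it. *)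
Lemma is_derive_on_unique (I : R -> Prop) (f : R -> C) (x : R) (l m : C) :
  interval I -> I x -> is_derive_on I f x l -> is_derive_on I f x m -> l = m.
Proof.
intros hI Ix. rewrite !is_derive_on_Cmod by assumption. intros Hl Hm.
destruct (Req_dec (Cmod (l - m)%C) 0) as [H0 | H0].
{ apply Ceq_minus, Cmod_eq_0, H0. }
exfalso.
assert (He : 0 < Cmod (l - m)%C / 4) by (pose proof (Cmod_ge_0 (l - m)%C); lra).
set (eps := mkposreal _ He).
destruct (Hl eps) as [d1 H1], (Hm eps) as [d2 H2].
destruct (interval_limit_point I x (Rmin d1 d2) hI Ix) as (y & Iy & yx & Hy).
{ apply Rmin_glb_lt; apply cond_pos. }
specialize (H1 y Iy (Rlt_le_trans _ _ _ Hy (Rmin_l _ _))).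
specialize (H2 y Iy (Rlt_le_trans _ _ _ Hy (Rmin_r _ _))).
assert (H3 : Cmod (RtoC (y - x) * (l - m))%C <= Cmod (l - m)%C / 2 * Rabs (y - x)).
{ replace (RtoC (y - x) * (l - m))%C
    with ((f y - f x - RtoC (y - x) * m) + - (f y - f x - RtoC (y - x) * l))%C by ring.
  eapply Rle_trans; [apply Cmod_triangle |]. rewrite Cmod_opp.
  simpl in H1, H2. lra. }
rewrite Cmod_mult, Cmod_R in H3.
assert (0 < Rabs (y - x)) by (apply Rabs_pos_lt; lra).
simpl in He. nra.
Qed.

Lemma Dop_eq (I : R -> Prop) (f g : R -> C) (x : R) :
  interval I -> deriv_on I f g -> I x -> Dop I f x = g x.
Proof.
intros hI H Ix. apply (iota_unique (V := C_R_CompleteNormedModule)).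
- intros l Hl. exact (is_derive_on_unique I f x l (g x) hI Ix Hl (H x Ix)).
- exact (H x Ix).
Qed.

Lemma deriv_on_ext (I : R -> Prop) (f1 g1 f2 g2 : R -> C) :
  (forall x : R, I x -> f1 x = f2 x) -> (forall x : R, I x -> g1 x = g2 x) ->
  deriv_on I f1 g1 -> deriv_on I f2 g2.
Proof.
intros Ef Eg H x Ix. apply (is_derive_on_ext I f1); try assumption.
rewrite <- Eg by assumption. exact (H x Ix).
Qed.

(** The values on [I] of all the operators considered depend only on the
    restriction of their argument to [I], even where the derivative fails to
    exist, because [iota] sees a predicate only up to equivalence. *)
Lemma Dop_ext (I : R -> Prop) (f g : R -> C) (x : R) :
  (forall y : R, I y -> f y = g y) -> I x -> Dop I f x = Dop I g x.
Proof.
intros E Ix. apply (eq_close (V := C_R_NormedModule)).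
apply (close_iota (T := C_R_CompleteNormedModule)). intros l.
split; apply is_derive_on_ext; try assumption.
intros y Iy. symmetry. exact (E y Iy).
Qed.

Lemma deriv_on_const (I : R -> Prop) (c : C) :
  deriv_on I (fun _ => c) (fun _ => RtoC 0).
Proof.
intros x Ix. apply is_derive_on_Cmod; [assumption |].
intros eps. exists eps. intros y _ _.
replace (c - c - RtoC (y - x) * RtoC 0)%C with (RtoC 0) by ring.
rewrite Cmod_0. apply Rmult_le_pos; [apply Rlt_le, cond_pos | apply Rabs_pos].
Qed.

Lemma deriv_on_plus (I : R -> Prop) (f f' g g' : R -> C) :
  deriv_on I f f' -> deriv_on I g g' ->
  deriv_on I (fun x => f x + g x)%C (fun x => f' x + g' x)%C.
Proof.
intros Hf Hg x Ix. specialize (Hf x Ix). specialize (Hg x Ix). revert Hf Hg.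
rewrite !is_derive_on_Cmod by assumption. intros Hf Hg eps.
assert (He : 0 < eps / 2) by (pose proof (cond_pos eps); lra).
destruct (Hf (mkposreal _ He)) as [d1 H1], (Hg (mkposreal _ He)) as [d2 H2].
exists (mkposreal (Rmin d1 d2) (Rmin_glb_lt _ _ _ (cond_pos d1) (cond_pos d2))).
intros y Iy Hy. simpl in Hy.
specialize (H1 y Iy (Rlt_le_trans _ _ _ Hy (Rmin_l _ _))).
specialize (H2 y Iy (Rlt_le_trans _ _ _ Hy (Rmin_r _ _))).
simpl in H1, H2.
replace (f y + g y - (f x + g x) - RtoC (y - x) * (f' x + g' x))%C
  with ((f y - f x - RtoC (y - x) * f' x) + (g y - g x - RtoC (y - x) * g' x))%C by ring.
eapply Rle_trans; [apply Cmod_triangle | lra].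
Qed.

Lemma deriv_on_mult (I : R -> Prop) (f f' g g' : R -> C) :
  deriv_on I f f' -> deriv_on I g g' ->
  deriv_on I (fun x => f x * g x)%C (fun x => f' x * g x + f x * g' x)%C.
Proof.
intros Hf Hg x Ix. specialize (Hf x Ix). specialize (Hg x Ix). revert Hf Hg.
rewrite !is_derive_on_Cmod by assumption. intros Hf Hg eps.
set (A := Cmod (f x)). set (B := Cmod (g x)). set (F := Cmod (f' x)). set (G := Cmod (g' x)).
assert (HA : 0 <= A) by apply Cmod_ge_0. assert (HB : 0 <= B) by apply Cmod_ge_0.
assert (HF : 0 <= F) by apply Cmod_ge_0. assert (HG : 0 <= G) by apply Cmod_ge_0.
pose proof (cond_pos eps) as Hpos.
set (M := (B + 1 + G) + A + F * (1 + G)).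
assert (HM : 0 < M) by (unfold M; nra).
set (e := Rmin 1 (eps / M)).
assert (He : 0 < e).
{ apply Rmin_glb_lt; [lra | apply Rdiv_lt_0_compat; lra]. }
assert (HeM : e * M <= eps).
{ assert (e <= eps / M) by apply Rmin_r.
  apply Rle_trans with (eps / M * M); [apply Rmult_le_compat_r; lra |].
  right. field. lra. }
assert (He1 : e <= 1) by apply Rmin_l.
destruct (Hf (mkposreal _ He)) as [d1 H1], (Hg (mkposreal _ He)) as [d2 H2].
exists (mkposreal (Rmin e (Rmin d1 d2))
  (Rmin_glb_lt _ _ _ He (Rmin_glb_lt _ _ _ (cond_pos d1) (cond_pos d2)))).
intros y Iy Hy. simpl in Hy.
assert (Hye : Rabs (y - x) < e) by exact (Rlt_le_trans _ _ _ Hy (Rmin_l _ _)).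
assert (Hy' := Rlt_le_trans _ _ _ Hy (Rmin_r _ _)).
specialize (H1 y Iy (Rlt_le_trans _ _ _ Hy' (Rmin_l _ _))).
specialize (H2 y Iy (Rlt_le_trans _ _ _ Hy' (Rmin_r _ _))).
simpl in H1, H2.
set (r := (f y - f x - RtoC (y - x) * f' x)%C) in *.
set (s := (g y - g x - RtoC (y - x) * g' x)%C) in *.
set (h := Rabs (y - x)) in *.
assert (Hh : 0 <= h) by apply Rabs_pos.
assert (Hdg : Cmod (g y - g x)%C <= h * (1 + G)).
{ replace (g y - g x)%C with (s + RtoC (y - x) * g' x)%C by (unfold s; ring).
  eapply Rle_trans; [apply Cmod_triangle |].
  rewrite Cmod_mult, Cmod_R. fold h G. nra. }
assert (Hg1 : Cmod (g y) <= B + 1 + G).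
{ replace (g y) with (g x + (g y - g x))%C by ring.
  eapply Rle_trans; [apply Cmod_triangle |]. fold B. nra. }
(* The three terms are the linearisation errors of f and g and the second
   order term (y - x) f'(x) (g y - g x). *)
replace (f y * g y - f x * g x - RtoC (y - x) * (f' x * g x + f x * g' x))%C
  with (r * g y + f x * s + RtoC (y - x) * f' x * (g y - g x))%C
  by (unfold r, s; ring).
eapply Rle_trans; [apply Cmod_triangle |].
eapply Rle_trans; [apply Rplus_le_compat_r, Cmod_triangle |].
rewrite !Cmod_mult, Cmod_R. fold h A F.
assert (T1 : Cmod r * Cmod (g y) <= (e * h) * (B + 1 + G)).
{ apply Rmult_le_compat; try apply Cmod_ge_0; assumption. }
assert (T2 : A * Cmod s <= A * (e * h)) by (apply Rmult_le_compat_l; assumption).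
assert (T3 : h * F * Cmod (g y - g x)%C <= h * F * (e * (1 + G))).
{ apply Rmult_le_compat_l; [nra |]. apply Rle_trans with (1 := Hdg).
  apply Rmult_le_compat_r; lra. }
apply Rle_trans with (e * M * h); [unfold M; lra | apply Rmult_le_compat_r; assumption].
Qed.

Lemma deriv_on_real (I : R -> Prop) (f f' : R -> R) :
  (forall x : R, I x -> is_derive f x (f' x)) ->
  deriv_on I (fun x => RtoC (f x)) (fun x => RtoC (f' x)).
Proof.
intros H x Ix. apply is_derive_on_Cmod; [assumption |]. intros eps.
destruct (H x Ix) as [_ Hd].
destruct (Hd x (fun P HP => HP) eps) as [d Hd'].
exists d. intros y _ Hy.
rewrite <- !RtoC_minus, <- RtoC_mult, <- RtoC_minus, Cmod_R.
exact (Hd' y Hy).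
Qed.

Lemma deriv_on_scal (I : R -> Prop) (c : C) (f f' : R -> C) :
  deriv_on I f f' -> deriv_on I (fun x => c * f x)%C (fun x => c * f' x)%C.
Proof.
intros H.
apply deriv_on_ext with (3 := deriv_on_mult _ _ _ _ _ (deriv_on_const I c) H);
  intros x _; ring.
Qed.

(** Precomposing with the retraction of the line onto [[x, y]], which is
    1-Lipschitz, gives a function differentiable everywhere with derivative
    zero; this avoids treating the endpoints of [I] apart. *)
Lemma deriv_on_zero_const (I : R -> Prop) (f : R -> C) :
  is_connected I -> deriv_on I f (fun _ => RtoC 0) ->
  forall x y : R, I x -> I y -> f x = f y.
Proof.
intros hc H.
assert (Hlt : forall x y : R, I x -> I y -> x < y -> f x = f y).
{ intros x y Ix Iy xy.
  set (p := fun s => Rmax x (Rmin y s)).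
  assert (Hp : forall s, x <= p s <= y).
  { intros s. unfold p, Rmax, Rmin.
    destruct (Rle_dec y s), (Rle_dec x _); lra. }
  assert (HpI : forall s, I (p s)) by (intros s; apply (hc x y); trivial).
  assert (Hp1 : forall s t, Rabs (p t - p s) <= Rabs (t - s)).
  { intros s t. unfold p, Rmax, Rmin.
    destruct (Rle_dec y s), (Rle_dec y t);
    repeat destruct (Rle_dec x _);
    unfold Rabs; repeat destruct (Rcase_abs _); lra. }
  replace (f x) with (f (p x)).
  2:{ f_equal. unfold p, Rmax, Rmin.
      destruct (Rle_dec y x), (Rle_dec x _); lra. }
  replace (f y) with (f (p y)).
  2:{ f_equal. unfold p, Rmax, Rmin.
      destruct (Rle_dec y y), (Rle_dec x _); lra. }
  apply (eq_is_derive (V := C_R_NormedModule) (fun s => f (p s)) x y); [| assumption].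
  intros s _.
  assert (Hs := proj1 (is_derive_on_Cmod I f (p s) _ (HpI s)) (H (p s) (HpI s))).
  assert (Hall : is_derive_on (fun _ => True) (fun s => f (p s)) s (RtoC 0)).
  { apply is_derive_on_Cmod; [trivial |].
    intros eps. destruct (Hs eps) as [d Hd]. exists d. intros t _ Ht.
    specialize (Hd (p t) (HpI t) (Rle_lt_trans _ _ _ (Hp1 s t) Ht)).
    rewrite Cmult_0_r in *.
    apply Rle_trans with (1 := Hd).
    apply Rmult_le_compat_l; [apply Rlt_le, cond_pos | apply Hp1]. }
  destruct Hall as [Hlin Hd]. split; [exact Hlin |].
  intros z Hz eps.
  assert (Hz' : is_filter_lim (within (fun _ => True) (locally s)) z).
  { intros P HP. unfold within. generalize (Hz P HP).
    apply filter_imp. intros; assumption. }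
  generalize (Hd z Hz' eps). unfold within.
  apply filter_imp. intros t Ht. exact (Ht Logic.I). }
intros x y Ix Iy. destruct (Rtotal_order x y) as [xy | [-> | xy]].
- exact (Hlt x y Ix Iy xy).
- reflexivity.
- symmetry. exact (Hlt y x Iy Ix xy).
Qed.

(** * Repeated differentiability *)

(** Differentiability of order [m] with witnesses for the successive
    derivatives, which suits the product rule better than iterates of [Dop]. *)
Fixpoint smooth (I : R -> Prop) (m : nat) (f : R -> C) : Prop :=
  match m with
  | O => True
  | S k => exists g : R -> C, deriv_on I f g /\ smooth I k g
  end.

Lemma smooth_ext (I : R -> Prop) (m : nat) (f g : R -> C) :
  (forall x : R, I x -> f x = g x) -> smooth I m f -> smooth I m g.
Proof.
destruct m as [| m]; [trivial |].
intros E (h & Hh & Sh). exists h. split; [| assumption].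
now apply deriv_on_ext with (3 := Hh).
Qed.

Lemma smooth_pred (I : R -> Prop) (m : nat) (f : R -> C) :
  smooth I (S m) f -> smooth I m f.
Proof.
revert f. induction m as [| m IH]; [easy |].
intros f (g & Hg & Sg). exists g. split; [assumption | now apply IH].
Qed.

Lemma smooth_const (I : R -> Prop) (m : nat) (c : C) : smooth I m (fun _ => c).
Proof.
revert c. induction m as [| m IH]; intros c; [easy |].
exists (fun _ => RtoC 0). split; [apply deriv_on_const | apply IH].
Qed.

Lemma smooth_plus (I : R -> Prop) (m : nat) (f g : R -> C) :
  smooth I m f -> smooth I m g -> smooth I m (fun x => f x + g x)%C.
Proof.
revert f g. induction m as [| m IH]; [easy |].
intros f g (f' & Hf & Sf) (g' & Hg & Sg).
exists (fun x => f' x + g' x)%C. split; [now apply deriv_on_plus | now apply IH].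
Qed.

Lemma smooth_mult (I : R -> Prop) (m : nat) (f g : R -> C) :
  smooth I m f -> smooth I m g -> smooth I m (fun x => f x * g x)%C.
Proof.
revert f g. induction m as [| m IH]; [easy |].
intros f g Sf Sg.
assert (Sf0 := smooth_pred _ _ _ Sf). assert (Sg0 := smooth_pred _ _ _ Sg).
destruct Sf as (f' & Hf & Sf), Sg as (g' & Hg & Sg).
exists (fun x => f' x * g x + f x * g' x)%C.
split; [now apply deriv_on_mult |].
apply smooth_plus; now apply IH.
Qed.

Lemma smooth_Dop (I : R -> Prop) (m : nat) (f : R -> C) :
  interval I -> smooth I (S m) f -> deriv_on I f (Dop I f) /\ smooth I m (Dop I f).
Proof.
intros hI (g & Hg & Sg).
assert (E : forall x, I x -> g x = Dop I f x)
  by (intros x Ix; symmetry; now apply Dop_eq).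
split; [now apply deriv_on_ext with (3 := Hg) | now apply smooth_ext with (2 := Sg)].
Qed.

Lemma diff_times_smooth (I : R -> Prop) (m : nat) (f : R -> C) :
  interval I -> (diff_times I m f <-> smooth I m f).
Proof.
intros hI. revert f. induction m as [| m IH]; intros f.
- split; [easy | intros _ k Hk; lia].
- split.
  + intros H. exists (Dop I f). split.
    * intros x Ix. destruct (H O (Nat.lt_0_succ m) x Ix) as [l Hl].
      simpl in Hl. unfold Dop.
      apply (iota_correct (V := C_R_CompleteNormedModule)).
      exists l. split; [assumption |].
      intros l' Hl'. exact (is_derive_on_unique I f x l l' hI Ix Hl Hl').
    * apply IH. intros k Hk x Ix. rewrite <- Nat.iter_succ_r.
      apply H; [lia | assumption].
  + intros Sf. apply smooth_Dop in Sf as [Hf Sf]; [| assumption].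
    apply IH in Sf. intros [| k] Hk x Ix.
    * exists (Dop I f x). exact (Hf x Ix).
    * rewrite Nat.iter_succ_r. apply Sf; [lia | assumption].
Qed.

(** * Second-order linear equations *)

(** The equation [f'' = q f] as a first-order system, [g] being the derivative
    of [f]; transformations of solutions then become algebra on pairs. *)
Definition sol (I : R -> Prop) (q : R -> R) (f g : R -> C) : Prop :=
  deriv_on I f g /\ deriv_on I g (fun x => RtoC (q x) * f x)%C.

Lemma sol_ext (I : R -> Prop) (q1 q2 : R -> R) (f1 f2 g : R -> C) :
  (forall x : R, I x -> q1 x = q2 x) -> (forall x : R, I x -> f1 x = f2 x) ->
  sol I q1 f1 g -> sol I q2 f2 g.
Proof.
intros Eq Ef [Hf Hg]. split.
- now apply deriv_on_ext with (3 := Hf).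
- apply deriv_on_ext with (3 := Hg); [easy |].
  intros x Ix. now rewrite Eq, Ef.
Qed.

Lemma solves_sol (I : R -> Prop) (q : R -> R) (f : R -> C) :
  interval I ->
  (solves I (sub_op (pow_op (Dop I) 2) (mul_op q)) f <-> exists g : R -> C, sol I q f g).
Proof.
intros hI. unfold solves. rewrite diff_times_smooth by assumption.
unfold sub_op, mul_op, pow_op. simpl Nat.iter. split.
- intros [Sf H]. apply smooth_Dop in Sf as [Hf Sf]; [| assumption].
  apply smooth_Dop in Sf as [Hf' _]; [| assumption].
  exists (Dop I f). split; [assumption |].
  apply deriv_on_ext with (3 := Hf'); [easy |].
  intros x Ix. apply Ceq_minus, H, Ix.
- intros (g & Hf & Hg). split.
  + exists g. split; [assumption |]. eexists; split; [exact Hg | exact Logic.I].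
  + intros x Ix. apply (proj1 (Ceq_minus _ _)).
    rewrite (Dop_ext I (Dop I f) g) by (trivial; intros y Iy; now apply Dop_eq).
    exact (Dop_eq I _ _ x hI Hg Ix).
Qed.

Lemma sol_lin_comb (I : R -> Prop) (q : R -> R) (u u' v v' : R -> C) (c1 c2 : C) :
  sol I q u u' -> sol I q v v' ->
  sol I q (lin_comb u v c1 c2) (lin_comb u' v' c1 c2).
Proof.
intros [Hu Hu'] [Hv Hv']. split.
- apply deriv_on_plus; now apply deriv_on_scal.
- apply deriv_on_ext with
    (3 := deriv_on_plus _ _ _ _ _ (deriv_on_scal _ c1 _ _ Hu') (deriv_on_scal _ c2 _ _ Hv'));
    [easy |].
  intros x _. unfold lin_comb. ring.
Qed.

Lemma sol_wronskian_const (I : R -> Prop) (q : R -> R) (u u' v v' : R -> C) :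
  is_connected I -> sol I q u u' -> sol I q v v' ->
  forall x y : R, I x -> I y ->
    (u x * v' x - u' x * v x)%C = (u y * v' y - u' y * v y)%C.
Proof.
intros hc [Hu Hu'] [Hv Hv'].
apply (deriv_on_zero_const I (fun x => u x * v' x - u' x * v x)%C); [assumption |].
apply deriv_on_ext with
  (3 := deriv_on_plus _ _ _ _ _ (deriv_on_mult _ _ _ _ _ Hu Hv')
          (deriv_on_scal _ (RtoC (-1)) _ _ (deriv_on_mult _ _ _ _ _ Hu' Hv)));
  intros x _; simpl; ring.
Qed.

(** With [W(f, g) = f g' - f' g], every solution satisfies
    [f W(u, v) = W(f, v) u + W(u, f) v] identically, and the three Wronskians
    are constant. *)
Lemma general_solution_wronskian (I : R -> Prop) (q : R -> R) (u u' v v' : R -> C) :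
  interval I -> sol I q u u' -> sol I q v v' ->
  (forall x : R, I x -> (u x * v' x - u' x * v x)%C <> RtoC 0) ->
  general_solution I (sub_op (pow_op (Dop I) 2) (mul_op q)) (lin_comb u v).
Proof.
intros hI Hu Hv HW f. rewrite solves_sol by assumption. split.
- intros [f' Hf]. destruct hI as [hc (x0 & _ & I0 & _)].
  set (W := (u x0 * v' x0 - u' x0 * v x0)%C).
  exists ((f x0 * v' x0 - f' x0 * v x0) / W)%C, ((u x0 * f' x0 - u' x0 * f x0) / W)%C.
  intros x Ix. unfold lin_comb.
  rewrite <- (sol_wronskian_const I q f f' v v' hc Hf Hv x x0 Ix I0).
  rewrite <- (sol_wronskian_const I q u u' f f' hc Hu Hf x x0 Ix I0).
  unfold W. rewrite <- (sol_wronskian_const I q u u' v v' hc Hu Hv x x0 Ix I0).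
  field. exact (HW x Ix).
- intros (c1 & c2 & E). exists (lin_comb u' v' c1 c2).
  apply sol_ext with (3 := sol_lin_comb _ _ _ _ _ _ c1 c2 Hu Hv); [easy |].
  intros x Ix. now rewrite E.
Qed.

(** The [m]-th derivative exists for all [m] since [f''] is a multiple of [f]; this
    puts the solutions in the domain of the operational identity. *)
Lemma sol_const_smooth (I : R -> Prop) (lam : R) (m : nat) (f g : R -> C) :
  sol I (fun _ => lam) f g -> smooth I m f.
Proof.
intros [Hf Hg].
enough (H : smooth I m f /\ smooth I m g) by easy.
induction m as [| m [Sf Sg]]; [easy |]. split.
- now exists g.
- eexists. split; [exact Hg |].
  apply smooth_mult; [apply smooth_const | assumption].
Qed.

(** * The equation with constant coefficient *)

Lemma deriv_on_Cexp (I : R -> Prop) (m : C) :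
  deriv_on I (fun x => Cexp (m * RtoC x)%C) (fun x => m * Cexp (m * RtoC x))%C.
Proof.
destruct m as [p q].
assert (H1 : deriv_on I (fun x => RtoC (exp (p * x) * cos (q * x)))
  (fun x => RtoC (p * (exp (p * x) * cos (q * x)) - q * (exp (p * x) * sin (q * x))))).
{ apply deriv_on_real. intros x _. auto_derive; [trivial | ring]. }
assert (H2 : deriv_on I (fun x => RtoC (exp (p * x) * sin (q * x)))
  (fun x => RtoC (p * (exp (p * x) * sin (q * x)) + q * (exp (p * x) * cos (q * x))))).
{ apply deriv_on_real. intros x _. auto_derive; [trivial | ring]. }
assert (E : forall x, Cexp ((p, q) * RtoC x)%C
  = (exp (p * x) * cos (q * x), exp (p * x) * sin (q * x))).
{ intros x. unfold Cexp. simpl.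
  replace (p * x - q * 0) with (p * x) by ring.
  replace (p * 0 + q * x) with (q * x) by ring. reflexivity. }
apply deriv_on_ext with (3 := deriv_on_plus _ _ _ _ _ H1 (deriv_on_scal _ Ci _ _ H2));
  intros x _; rewrite E; unfold Cplus, Cmult, Ci, RtoC; simpl; f_equal; ring.
Qed.

Lemma Cexp_opp_r (z : C) : (Cexp z * Cexp (- z))%C = RtoC 1.
Proof.
destruct z as [p q]. unfold Cexp, Cmult, Copp, RtoC. simpl.
rewrite cos_neg, sin_neg.
assert (H : exp p * exp (- p) = 1) by (rewrite exp_Ropp; field; apply Rgt_not_eq, exp_pos).
assert (H2 := sin2_cos2 q). unfold Rsqr in H2.
f_equal; [| ring].
transitivity (exp p * exp (- p) * (sin q * sin q + cos q * cos q)); [ring |].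
rewrite H, H2. ring.
Qed.

Lemma Csqrt_real_sqr (l : R) : (Csqrt_real l * Csqrt_real l)%C = RtoC l.
Proof.
unfold Csqrt_real, Cmult, RtoC. simpl.
destruct (Rle_dec 0 l) as [Hl | Hl].
- rewrite sqrt_sqrt by assumption. rewrite (sqrt_neg_0 (- l)) by lra. f_equal; ring.
- rewrite (sqrt_sqrt (- l)) by lra. rewrite (sqrt_neg_0 l) by lra. f_equal; ring.
Qed.

Lemma general_solution_Cexp (I : R -> Prop) (lam : R) :
  interval I -> lam <> 0 ->
  general_solution I (sub_op (pow_op (Dop I) 2) (mul_op (fun _ => lam)))
    (lin_comb (fun x => Cexp (Cmult (Csqrt_real lam) (RtoC x)))
              (fun x => Cexp (Copp (Cmult (Csqrt_real lam) (RtoC x))))).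
Proof.
intros hI hl. set (m := Csqrt_real lam).
assert (Hm : (m * m)%C = RtoC lam) by apply Csqrt_real_sqr.
assert (Hm0 : m <> RtoC 0).
{ intros E. rewrite E, Cmult_0_l in Hm. apply hl. now apply RtoC_inj. }
assert (D1 := deriv_on_Cexp I m).
assert (D2 : deriv_on I (fun x => Cexp (- (m * RtoC x))%C)
  (fun x => - m * Cexp (- (m * RtoC x)))%C).
{ apply deriv_on_ext with (3 := deriv_on_Cexp I (- m)%C);
    intros x _; replace (- m * RtoC x)%C with (- (m * RtoC x))%C by ring; reflexivity. }
apply general_solution_wronskian with
  (u' := fun x => (m * Cexp (m * RtoC x))%C) (v' := fun x => (- m * Cexp (- (m * RtoC x)))%C);
  [assumption | | |].
- split; [assumption |].
  apply deriv_on_ext with (3 := deriv_on_scal _ m _ _ D1); [easy |].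
  intros x _. rewrite <- Hm. ring.
- split; [assumption |].
  apply deriv_on_ext with (3 := deriv_on_scal _ (- m)%C _ _ D2); [easy |].
  intros x _. rewrite <- Hm. ring.
- intros x _.
  replace (Cexp (m * RtoC x) * (- m * Cexp (- (m * RtoC x)))
           - m * Cexp (m * RtoC x) * Cexp (- (m * RtoC x)))%C
    with (RtoC (-2) * m * (Cexp (m * RtoC x) * Cexp (- (m * RtoC x))))%C by ring.
  rewrite Cexp_opp_r, Cmult_1_r. apply Cmult_neq_0; [| assumption].
  intros E. apply RtoC_inj in E. lra.
Qed.

Lemma general_solution_real (I : R -> Prop) (lam w : R) (u u' v v' : R -> R) :
  interval I -> w <> 0 ->
  (forall x : R, is_derive u x (u' x)) -> (forall x : R, is_derive u' x (lam * u x)) ->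
  (forall x : R, is_derive v x (v' x)) -> (forall x : R, is_derive v' x (lam * v x)) ->
  (forall x : R, u x * v' x - u' x * v x = w) ->
  general_solution I (sub_op (pow_op (Dop I) 2) (mul_op (fun _ => lam)))
    (lin_comb (fun x => RtoC (u x)) (fun x => RtoC (v x))).
Proof.
intros hI hw Hu Hu' Hv Hv' HW.
assert (Hsol : forall f f', (forall x : R, is_derive f x (f' x)) ->
  (forall x : R, is_derive f' x (lam * f x)) ->
  sol I (fun _ => lam) (fun x => RtoC (f x)) (fun x => RtoC (f' x))).
{ intros f f' Hf Hf'. split; [now apply deriv_on_real |].
  apply deriv_on_ext with (3 := deriv_on_real I _ _ (fun x _ => Hf' x)); [easy |].
  intros x _. now rewrite RtoC_mult. }
apply general_solution_wronskian with
  (u' := fun x => RtoC (u' x)) (v' := fun x => RtoC (v' x)); auto.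
intros x _. rewrite <- !RtoC_mult, <- RtoC_minus, HW.
intros E. apply RtoC_inj in E. contradiction.
Qed.

Lemma general_solution_cosh_sinh (I : R -> Prop) (lam : R) :
  interval I -> 0 < lam ->
  general_solution I (sub_op (pow_op (Dop I) 2) (mul_op (fun _ => lam)))
    (lin_comb (fun x => RtoC (cosh (sqrt lam * x))) (fun x => RtoC (sinh (sqrt lam * x)))).
Proof.
intros hI hl. set (m := sqrt lam).
assert (Hm : lam = m * m) by (unfold m; rewrite sqrt_sqrt; lra).
assert (Hm0 : m <> 0) by (intros E; rewrite E in Hm; lra).
apply general_solution_real with (w := m)
  (u' := fun x => m * sinh (m * x)) (v' := fun x => m * cosh (m * x)); trivial;
  unfold cosh, sinh.
1-4: intros x; auto_derive; [trivial | rewrite ?Hm; field].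
intros x.
assert (E : exp (m * x) * exp (- (m * x)) = 1)
  by (rewrite exp_Ropp; field; apply Rgt_not_eq, exp_pos).
transitivity (m * (exp (m * x) * exp (- (m * x)))); [field | rewrite E; ring].
Qed.

Lemma general_solution_cos_sin (I : R -> Prop) (lam : R) :
  interval I -> lam < 0 ->
  general_solution I (sub_op (pow_op (Dop I) 2) (mul_op (fun _ => lam)))
    (lin_comb (fun x => RtoC (cos (sqrt (- lam) * x))) (fun x => RtoC (sin (sqrt (- lam) * x)))).
Proof.
intros hI hl. set (m := sqrt (- lam)).
assert (Hm : lam = - (m * m)) by (unfold m; rewrite sqrt_sqrt; lra).
assert (Hm0 : m <> 0) by (intros E; rewrite E in Hm; lra).
apply general_solution_real with (w := m)
  (u' := fun x => - m * sin (m * x)) (v' := fun x => m * cos (m * x)); trivial.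
1-4: intros x; auto_derive; [trivial | rewrite ?Hm; ring].
intros x. assert (E := sin2_cos2 (m * x)). unfold Rsqr in E.
transitivity (m * (sin (m * x) * sin (m * x) + cos (m * x) * cos (m * x))); [ring |].
rewrite E. ring.
Qed.

(** * Darboux transformations *)

(** The logarithmic derivative of [a x + b]. *)
Definition logder (a b x : R) : R := a / (a * x + b).

Lemma deriv_on_logder (I : R -> Prop) (a b : R) :
  (forall x : R, I x -> a * x + b <> 0) ->
  deriv_on I (fun x => RtoC (logder a b x)) (fun x => RtoC (- logder a b x ^ 2)).
Proof.
intros hab. apply deriv_on_real. intros x Ix. unfold logder.
auto_derive; [now apply hab | field; now apply hab].
Qed.

(** [r = 1 / (a x + b)] satisfies [r' = - a r^2], so smoothness of order [m]
    gives order [m + 1]. *)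
Lemma smooth_inv_affine (I : R -> Prop) (a b : R) (m : nat) :
  (forall x : R, I x -> a * x + b <> 0) -> smooth I m (fun x => RtoC (1 / (a * x + b))).
Proof.
intros hab. set (r := fun x => RtoC (1 / (a * x + b))).
induction m as [| m IH]; [exact Logic.I |].
exists (fun x => RtoC (- a) * (r x * r x))%C. split.
- apply deriv_on_ext with (f1 := r) (g1 := fun x => RtoC (- a * (1 / (a * x + b)) ^ 2));
    [easy | |].
  + intros x _. unfold r. rewrite <- !RtoC_mult. f_equal. ring.
  + apply deriv_on_real. intros x Ix.
    auto_derive; [now apply hab | field; now apply hab].
- apply smooth_mult; [apply smooth_const | now apply smooth_mult].
Qed.

(** The transform is stated for real [k] so that the instance at [- k] is the
    lowering map: [k (k - 1)] and [k (k + 1)] are exchanged by [k -> - k].  The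
    derivative [z' - (k s y)'] is rewritten with [z' = (lam + k (k - 1) s^2) y]
    and [s' = - s^2]. *)
Lemma darboux_transform (I : R -> Prop) (a b lam k : R) (y z : R -> C) :
  (forall x : R, I x -> a * x + b <> 0) ->
  sol I (fun x => lam + k * (k - 1) * logder a b x ^ 2) y z ->
  sol I (fun x => lam + k * (k + 1) * logder a b x ^ 2)
    (fun x => z x - RtoC (k * logder a b x) * y x)%C
    (fun x => RtoC (lam + k ^ 2 * logder a b x ^ 2) * y x - RtoC (k * logder a b x) * z x)%C.
Proof.
intros hab [Hy Hz].
assert (Hs := deriv_on_logder I a b hab).
assert (Hsy := deriv_on_mult _ _ _ _ _ Hs Hy).
assert (Hssy := deriv_on_mult _ _ _ _ _ Hs Hsy).
assert (Hsz := deriv_on_mult _ _ _ _ _ Hs Hz).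
split.
- apply deriv_on_ext with
    (3 := deriv_on_plus _ _ _ _ _ Hz (deriv_on_scal _ (RtoC (- k)) _ _ Hsy));
    intros x _; rewrite ?RtoC_plus, ?RtoC_mult, ?RtoC_opp, ?RtoC_pow, ?RtoC_plus,
      ?RtoC_minus, ?RtoC_mult; ring.
- apply deriv_on_ext with
    (3 := deriv_on_plus _ _ _ _ _ (deriv_on_scal _ (RtoC lam) _ _ Hy)
            (deriv_on_plus _ _ _ _ _ (deriv_on_scal _ (RtoC (k ^ 2)) _ _ Hssy)
              (deriv_on_scal _ (RtoC (- k)) _ _ Hsz)));
    intros x _; repeat rewrite ?RtoC_plus, ?RtoC_minus, ?RtoC_mult, ?RtoC_opp, ?RtoC_pow; ring.
Qed.

Definition raising_op (I : R -> Prop) (a b : R) (k : nat) : operator :=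
  sub_op (Dop I) (mul_op (fun x => INR k * (a / (a * x + b)))).

Lemma prod_op_raising_ext (I : R -> Prop) (a b : R) (m : nat) (f g : R -> C) :
  (forall x : R, I x -> f x = g x) ->
  forall x : R, I x ->
    prod_op (raising_op I a b) m f x = prod_op (raising_op I a b) m g x.
Proof.
assert (step : forall k f g, (forall x : R, I x -> f x = g x) ->
  forall x : R, I x -> raising_op I a b k f x = raising_op I a b k g x).
{ intros k u v E x Ix. unfold raising_op, sub_op, mul_op.
  now rewrite (Dop_ext I u v x E Ix), E. }
intros E. induction m as [| m IH]; [now apply step |].
exact (step (S m) _ _ IH).
Qed.

(** The first factor, [k = 0], is [D]: it preserves the equation with constant
    coefficient, in accordance with [0 (0 - 1) = 0 (0 + 1)]. *)
Lemma ladder_up (I : R -> Prop) (a b lam : R) (m : nat) (y z : R -> C) :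
  interval I -> (forall x : R, I x -> a * x + b <> 0) ->
  sol I (fun _ => lam) y z ->
  exists w : R -> C,
    sol I (fun x => lam + INR m * (INR m + 1) * logder a b x ^ 2)
      (prod_op (raising_op I a b) m y) w.
Proof.
intros hI hab Hyz.
assert (step : forall k u u',
  sol I (fun x => lam + INR k * (INR k - 1) * logder a b x ^ 2) u u' ->
  exists w, sol I (fun x => lam + INR k * (INR k + 1) * logder a b x ^ 2)
      (raising_op I a b k u) w).
{ intros k u u' Hu. eexists.
  apply sol_ext with (3 := darboux_transform I a b lam (INR k) u u' hab Hu); [easy |].
  intros x Ix. unfold raising_op, sub_op, mul_op.
  now rewrite (Dop_eq I u u' x hI (proj1 Hu) Ix). }
induction m as [| m [w Hw]].
- apply step with z. apply sol_ext with (3 := Hyz); [| easy].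
  intros x _. simpl. ring.
- apply (step (S m) _ w). apply sol_ext with (3 := Hw); [| easy].
  intros x _. rewrite S_INR. ring.
Qed.

(** The preimage of [w] is [(w' + k s w) / lam], the lowering map divided by
    [lam]: the raising map applied to it gives [w] because the product of the two
    operators is [D^2 - k (k + 1) s^2], which acts on [w] as [lam]. *)
Lemma raising_onto (I : R -> Prop) (a b lam : R) (k : nat) (w w' : R -> C) :
  interval I -> (forall x : R, I x -> a * x + b <> 0) -> lam <> 0 ->
  sol I (fun x => lam + INR k * (INR k + 1) * logder a b x ^ 2) w w' ->
  exists u u' : R -> C,
    sol I (fun x => lam + INR k * (INR k - 1) * logder a b x ^ 2) u u' /\
    forall x : R, I x -> raising_op I a b k u x = w x.
Proof.
intros hI hab hl Hw.
assert (Hd : sol I (fun x => lam + (- INR k) * (- INR k - 1) * logder a b x ^ 2) w w').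
{ apply sol_ext with (3 := Hw); [intros x _; ring | easy]. }
apply darboux_transform in Hd; [| assumption].
set (u := fun x => (w' x - RtoC (- INR k * logder a b x) * w x)%C) in Hd.
match type of Hd with sol _ _ _ ?v => set (u' := v) in Hd end.
exists (fun x => / RtoC lam * u x)%C, (fun x => / RtoC lam * u' x)%C.
destruct Hd as [Hu Hu'].
assert (Hu1 := deriv_on_scal I (/ RtoC lam)%C _ _ Hu).
split.
- split; [assumption |].
  apply deriv_on_ext with (3 := deriv_on_scal I (/ RtoC lam)%C _ _ Hu'); [easy |].
  intros x _. cbv beta.
  replace (lam + - INR k * (- INR k + 1) * logder a b x ^ 2)
    with (lam + INR k * (INR k - 1) * logder a b x ^ 2) by ring. ring.
- intros x Ix. unfold raising_op, sub_op, mul_op.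
  rewrite (Dop_eq I _ _ x hI Hu1 Ix). fold (logder a b x). unfold u', u.
  repeat rewrite ?RtoC_plus, ?RtoC_minus, ?RtoC_mult, ?RtoC_opp, ?RtoC_pow.
  field. intros E. apply RtoC_inj in E. contradiction.
Qed.

Lemma ladder_onto (I : R -> Prop) (a b lam : R) (m : nat) (w w' : R -> C) :
  interval I -> (forall x : R, I x -> a * x + b <> 0) -> lam <> 0 ->
  sol I (fun x => lam + INR m * (INR m + 1) * logder a b x ^ 2) w w' ->
  exists y z : R -> C, sol I (fun _ => lam) y z /\
    forall x : R, I x -> prod_op (raising_op I a b) m y x = w x.
Proof.
intros hI hab hl. revert w w'. induction m as [| m IH]; intros w w' Hw;
  destruct (raising_onto I a b lam _ w w' hI hab hl Hw) as (u & u' & Hu & E).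
- exists u, u'. split; [| assumption].
  apply sol_ext with (3 := Hu); [| easy]. intros x _. simpl. ring.
- destruct (IH u u') as (y & z & Hy & Ey).
  { apply sol_ext with (3 := Hu); [| easy]. intros x _. rewrite S_INR. ring. }
  exists y, z. split; [assumption |].
  intros x Ix. rewrite <- E by assumption. simpl. unfold comp_op, raising_op at 1, sub_op, mul_op.
  rewrite (Dop_ext I (prod_op (raising_op I a b) m y) u x Ey Ix), Ey by assumption.
  reflexivity.
Qed.

(** The raising maps send solutions onto solutions, so they carry any
    parametrisation [y0] of the solutions at level [0] to one at level [n]. *)
Lemma general_solution_ladder (I : R -> Prop) (a b lam : R) (n : nat) (y0 : C -> C -> R -> C) :
  interval I -> (forall x : R, I x -> a * x + b <> 0) -> lam <> 0 ->
  general_solution I (sub_op (pow_op (Dop I) 2) (mul_op (fun _ => lam))) y0 ->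
  general_solution I
    (sub_op (pow_op (Dop I) 2)
       (mul_op (fun x => lam + INR n * (INR n + 1) * a ^ 2 / (a * x + b) ^ 2)))
    (fun c1 c2 => prod_op (raising_op I a b) n (y0 c1 c2)).
Proof.
intros hI hab hl H0 f. rewrite solves_sol by assumption.
assert (Eq : forall x, I x -> lam + INR n * (INR n + 1) * logder a b x ^ 2
  = lam + INR n * (INR n + 1) * a ^ 2 / (a * x + b) ^ 2).
{ intros x Ix. unfold logder. field. now apply hab. }
split.
- intros [f' Hf]. destruct (ladder_onto I a b lam n f f') as (y & z & Hy & Ey);
    [assumption .. | |].
  { apply sol_ext with (3 := Hf); [| easy]. intros x Ix. symmetry. now apply Eq. }
  destruct (proj1 (H0 y)) as (c1 & c2 & E).
  { apply solves_sol; [assumption | now exists z]. }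
  exists c1, c2. intros x Ix. rewrite <- Ey by assumption.
  now apply prod_op_raising_ext.
- intros (c1 & c2 & E).
  assert (Hs : solves I (sub_op (pow_op (Dop I) 2) (mul_op (fun _ => lam))) (y0 c1 c2))
    by (apply H0; now exists c1, c2).
  apply solves_sol in Hs as [z Hz]; [| assumption].
  destruct (ladder_up I a b lam n _ z hI hab Hz) as [w Hw].
  exists w. apply sol_ext with (3 := Hw); [assumption |].
  intros x Ix. symmetry. now apply E.
Qed.

(** * The operational identity *)

Definition inv_affine_D (I : R -> Prop) (a b : R) : operator :=
  comp_op (mul_op (fun x => 1 / (a * x + b))) (Dop I).

(** Smoothness of order [j] in excess is carried along because the induction step
    has to differentiate [((1 / (a x + b)) D)^(m + 1) f] once more.  In that step
    the derivative of the factor [(a x + b)^(m + 1)] is exactly cancelled by the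
    term [- (m + 1) s]. *)
Lemma operational_identity (I : R -> Prop) (a b : R) (m j : nat) (f : R -> C) :
  interval I -> (forall x : R, I x -> a * x + b <> 0) ->
  smooth I (S m + j) f ->
  smooth I j (pow_op (inv_affine_D I a b) (S m) f) /\
  forall x : R, I x ->
    prod_op (raising_op I a b) m f x
    = (RtoC ((a * x + b) ^ S m) * pow_op (inv_affine_D I a b) (S m) f x)%C.
Proof.
intros hI hab.
assert (Q : forall i g, smooth I (S i) g -> smooth I i (inv_affine_D I a b g)).
{ intros i g Sg. apply smooth_mult; [now apply smooth_inv_affine |].
  now apply smooth_Dop. }
revert j. induction m as [| m IH]; intros j Sf.
- split; [now apply Q |].
  intros x Ix. simpl. unfold raising_op, inv_affine_D, sub_op, comp_op, mul_op. simpl.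
  assert (Hx := hab x Ix).
  repeat rewrite ?RtoC_mult, ?RtoC_div by assumption.
  field. intros E. apply RtoC_inj in E. contradiction.
- destruct (IH (S j)) as [SQ E].
  { now replace (S m + S j)%nat with (S (S m) + j)%nat by lia. }
  split; [now apply Q |].
  intros x Ix.
  change (pow_op (inv_affine_D I a b) (S (S m)) f) with
    (inv_affine_D I a b (pow_op (inv_affine_D I a b) (S m) f)).
  set (g := pow_op (inv_affine_D I a b) (S m) f) in *.
  apply smooth_Dop in SQ as [Hg _]; [| assumption].
  assert (Ht : deriv_on I (fun x => RtoC ((a * x + b) ^ S m))
    (fun x => RtoC (INR (S m) * a * (a * x + b) ^ m))).
  { apply deriv_on_real. intros t It. auto_derive; [trivial |].
    (* [auto_derive] leaves [INR (S m)] unfolded as a match, opaque to [ring]. *)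
    change (a * 1 * (INR (S m) * (a * t + b) ^ m) = INR (S m) * a * (a * t + b) ^ m).
    ring. }
  change (prod_op (raising_op I a b) (S m) f x)
    with (raising_op I a b (S m) (prod_op (raising_op I a b) m f) x).
  unfold raising_op at 1, sub_op, mul_op.
  rewrite (Dop_ext I _ _ x E Ix), E by assumption.
  rewrite (Dop_eq I _ _ x hI (deriv_on_mult _ _ _ _ _ Ht Hg) Ix).
  unfold inv_affine_D, comp_op, mul_op. simpl pow.
  assert (Hx := hab x Ix).
  repeat rewrite ?RtoC_mult, ?RtoC_div by assumption.
  field. intros E0. apply RtoC_inj in E0. contradiction.
Qed.

(** * Factorization and solutions for a zero eigenvalue *)

(** The product rule gives [(k s f)' = k s f' - k s^2 f], and its first-order part
    cancels against the term [- k s f'] of the outer factor. *)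
Lemma factorization (I : R -> Prop) (a b k : R) (f : R -> C) (x : R) :
  interval I -> (forall x : R, I x -> a * x + b <> 0) -> smooth I 2 f -> I x ->
  (Dop I (fun t => Dop I f t + RtoC (k * logder a b t) * f t)
     x - RtoC (k * logder a b x) * (Dop I f x + RtoC (k * logder a b x) * f x))%C
  = (Dop I (Dop I f) x - RtoC (k * (k + 1) * logder a b x ^ 2) * f x)%C.
Proof.
intros hI hab Sf Ix.
apply smooth_Dop in Sf as [Hf Sf]; [| assumption].
apply smooth_Dop in Sf as [Hf' _]; [| assumption].
assert (H : deriv_on I (fun t => Dop I f t + RtoC (k * logder a b t) * f t)%C
  (fun t => Dop I (Dop I f) t
     + RtoC k * (RtoC (- logder a b t ^ 2) * f t + RtoC (logder a b t) * Dop I f t))%C).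
{ apply deriv_on_ext with
    (3 := deriv_on_plus _ _ _ _ _ Hf' (deriv_on_scal _ (RtoC k) _ _
            (deriv_on_mult _ _ _ _ _ (deriv_on_logder I a b hab) Hf))); [| easy].
  intros t _. rewrite RtoC_mult. ring. }
rewrite (Dop_eq I _ _ x hI H Ix).
repeat rewrite ?RtoC_plus, ?RtoC_minus, ?RtoC_mult, ?RtoC_opp, ?RtoC_pow. ring.
Qed.

(** Describing the power [u = (a x + b)^k] by [u' = k s u] treats the exponents
    [k = n + 1] and [k = - n] alike. *)
Lemma sol_power (I : R -> Prop) (a b : R) (k : R) (u : R -> R) :
  (forall x : R, I x -> a * x + b <> 0) ->
  (forall x : R, I x -> is_derive u x (k * logder a b x * u x)) ->
  sol I (fun x => k * (k - 1) * logder a b x ^ 2)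
    (fun x => RtoC (u x)) (fun x => RtoC (k * logder a b x * u x)).
Proof.
intros hab Hu. assert (Hd := deriv_on_real I _ _ Hu). split; [assumption |].
apply deriv_on_ext with
  (3 := deriv_on_scal _ (RtoC k) _ _
          (deriv_on_mult _ _ _ _ _ (deriv_on_logder I a b hab) Hd));
  intros x _; repeat rewrite ?RtoC_plus, ?RtoC_minus, ?RtoC_mult, ?RtoC_opp, ?RtoC_pow; ring.
Qed.

Lemma general_solution_powers (I : R -> Prop) (a b : R) (n : nat) :
  a <> 0 -> interval I -> (forall x : R, I x -> a * x + b <> 0) ->
  general_solution I
    (sub_op (pow_op (Dop I) 2)
       (mul_op (fun x => INR n * (INR n + 1) * a ^ 2 / (a * x + b) ^ 2)))
    (lin_comb (fun x => RtoC ((a * x + b) ^ (n + 1))) (fun x => RtoC (/ (a * x + b) ^ n))).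
Proof.
intros ha hI hab. rewrite Nat.add_1_r.
assert (Eq : forall x, I x -> INR n * (INR n + 1) * logder a b x ^ 2
  = INR n * (INR n + 1) * a ^ 2 / (a * x + b) ^ 2).
{ intros x Ix. unfold logder. field. now apply hab. }
assert (Hu : forall x, I x -> is_derive (fun x => (a * x + b) ^ S n) x
  ((INR n + 1) * logder a b x * (a * x + b) ^ S n)).
{ intros x Ix. unfold logder. auto_derive; [trivial |].
  change (a * 1 * (INR (S n) * (a * x + b) ^ n)
    = (INR n + 1) * (a / (a * x + b)) * ((a * x + b) * (a * x + b) ^ n)).
  rewrite S_INR. field. now apply hab. }
assert (Hv : forall x, I x -> is_derive (fun x => / (a * x + b) ^ n) x
  (- INR n * logder a b x * / (a * x + b) ^ n)).
{ intros x Ix. unfold logder. assert (Hx := hab x Ix).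
  auto_derive; [now apply pow_nonzero |].
  destruct n as [| n]; [simpl; field; assumption |].
  simpl Init.Nat.pred. simpl pow. field. split; [now apply pow_nonzero | assumption]. }
apply sol_power in Hu; [| assumption]. apply sol_power in Hv; [| assumption].
eapply general_solution_wronskian; [assumption | | |].
- apply sol_ext with (3 := Hu); [| easy].
  intros x Ix. rewrite <- Eq by assumption. ring.
- apply sol_ext with (3 := Hv); [| easy].
  intros x Ix. rewrite <- Eq by assumption. ring.
- intros x Ix. assert (Hx := hab x Ix). cbv beta.
  rewrite <- !RtoC_mult, <- RtoC_minus. intros E. apply RtoC_inj in E.
  (* The Wronskian of the two powers is the constant [- (2 n + 1) a]. *)
  assert (E' : - (2 * INR n + 1) * a = 0).
  { rewrite <- E. unfold logder. simpl pow. field.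
    split; [now apply pow_nonzero | assumption]. }
  pose proof (pos_INR n). apply Rmult_integral in E' as [E' | E']; lra.
Qed.

(** * The theorem *)

Theorem mainTheorem2 (n : nat) (a b lam : R) (I : R -> Prop)
    (hn : (1 <= n)%nat) (ha : a <> 0) (hI : interval I)
    (hab : forall x : R, I x -> a * x + b <> 0) :
  eq_op_on I (n + 1)
    (prod_op (fun k => sub_op (Dop I) (mul_op (fun x => INR k * (a / (a * x + b))))) n)
    (comp_op (mul_op (fun x => (a * x + b) ^ (n + 1)))
       (pow_op (comp_op (mul_op (fun x => 1 / (a * x + b))) (Dop I)) (n + 1)))
  /\
  (lam <> 0 ->
     general_solution I (sub_op (pow_op (Dop I) 2) (mul_op (fun _ => lam)))
       (lin_comb (fun x => Cexp (Cmult (Csqrt_real lam) (RtoC x)))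
                 (fun x => Cexp (Copp (Cmult (Csqrt_real lam) (RtoC x)))))
     /\
     (0 < lam ->
        general_solution I (sub_op (pow_op (Dop I) 2) (mul_op (fun _ => lam)))
          (lin_comb (fun x => RtoC (cosh (sqrt lam * x)))
                    (fun x => RtoC (sinh (sqrt lam * x)))))
     /\
     (lam < 0 ->
        general_solution I (sub_op (pow_op (Dop I) 2) (mul_op (fun _ => lam)))
          (lin_comb (fun x => RtoC (cos (sqrt (- lam) * x)))
                    (fun x => RtoC (sin (sqrt (- lam) * x)))))
     /\
     (forall y0 : C -> C -> R -> C,
        general_solution I (sub_op (pow_op (Dop I) 2) (mul_op (fun _ => lam))) y0 ->
        general_solution I
          (sub_op (pow_op (Dop I) 2)
             (mul_op (fun x =>
                lam + INR n * (INR n + 1) * a ^ 2 / (a * x + b) ^ 2)))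
          (fun c1 c2 =>
             comp_op (mul_op (fun x => (a * x + b) ^ (n + 1)))
               (pow_op (comp_op (mul_op (fun x => 1 / (a * x + b))) (Dop I)) (n + 1))
               (y0 c1 c2))))
  /\
  (lam = 0 ->
     eq_op_on I 2
       (sub_op (pow_op (Dop I) 2)
          (mul_op (fun x => INR n * (INR n + 1) * a ^ 2 / (a * x + b) ^ 2)))
       (comp_op (sub_op (Dop I) (mul_op (fun x => INR n * a / (a * x + b))))
                (add_op (Dop I) (mul_op (fun x => INR n * a / (a * x + b)))))
     /\
     eq_op_on I 2
       (sub_op (pow_op (Dop I) 2)
          (mul_op (fun x => INR n * (INR n + 1) * a ^ 2 / (a * x + b) ^ 2)))
       (comp_op (add_op (Dop I) (mul_op (fun x => (INR n + 1) * a / (a * x + b))))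
                (sub_op (Dop I) (mul_op (fun x => (INR n + 1) * a / (a * x + b)))))
     /\
     general_solution I
       (sub_op (pow_op (Dop I) 2)
          (mul_op (fun x => INR n * (INR n + 1) * a ^ 2 / (a * x + b) ^ 2)))
       (lin_comb (fun x => RtoC ((a * x + b) ^ (n + 1)))
                 (fun x => RtoC (/ (a * x + b) ^ n)))).
Proof.
set (T := comp_op (mul_op (fun x => (a * x + b) ^ (n + 1)))
       (pow_op (comp_op (mul_op (fun x => 1 / (a * x + b))) (Dop I)) (n + 1))).
assert (HT : forall f : R -> C, smooth I (n + 1) f ->
  forall x : R, I x -> prod_op (raising_op I a b) n f x = T f x).
{ intros f Sf x Ix. unfold T. rewrite Nat.add_1_r in *.
  apply (operational_identity I a b n 0 f); trivial. now rewrite Nat.add_0_r. }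
split; [| split].
- intros f Hf x Ix. apply HT; [| assumption]. now apply diff_times_smooth.
- intros hl. split; [| split; [| split]].
  + now apply general_solution_Cexp.
  + now apply general_solution_cosh_sinh.
  + now apply general_solution_cos_sin.
  + intros y0 H0 f.
    rewrite (general_solution_ladder I a b lam n y0 hI hab hl H0 f).
    assert (S0 : forall c1 c2, smooth I (n + 1) (y0 c1 c2)).
    { intros c1 c2.
      assert (Hs : solves I (sub_op (pow_op (Dop I) 2) (mul_op (fun _ => lam))) (y0 c1 c2))
        by (apply H0; now exists c1, c2).
      apply solves_sol in Hs as [z Hz]; [| assumption].
      exact (sol_const_smooth I lam (n + 1) _ z Hz). }
    split; intros (c1 & c2 & E); exists c1, c2; intros x Ix; rewrite E by assumption;
      [| symmetry]; apply HT; trivial.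
- intros _. split; [| split].
  + intros f Hf x Ix. apply diff_times_smooth in Hf; [| assumption].
    assert (F := factorization I a b (INR n) f x hI hab Hf Ix).
    assert (L : forall t, INR n * a / (a * t + b) = INR n * logder a b t)
      by (intros t; unfold logder, Rdiv; ring).
    assert (Q : INR n * (INR n + 1) * a ^ 2 / (a * x + b) ^ 2
      = INR n * (INR n + 1) * logder a b x ^ 2)
      by (unfold logder; field; now apply hab).
    unfold comp_op, sub_op, add_op, mul_op, pow_op. simpl Nat.iter.
    rewrite Q, L, <- F. f_equal. apply Dop_ext; [| assumption].
    intros t _. now rewrite L.
  + intros f Hf x Ix. apply diff_times_smooth in Hf; [| assumption].
    assert (F := factorization I a b (- (INR n + 1)) f x hI hab Hf Ix).
    assert (L : forall t, RtoC (- (INR n + 1) * logder a b t)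
      = Copp (RtoC ((INR n + 1) * a / (a * t + b))))
      by (intros t; rewrite <- RtoC_opp; f_equal; unfold logder, Rdiv; ring).
    assert (Q : INR n * (INR n + 1) * a ^ 2 / (a * x + b) ^ 2
      = - (INR n + 1) * (- (INR n + 1) + 1) * logder a b x ^ 2)
      by (unfold logder; field; now apply hab).
    unfold comp_op, sub_op, add_op, mul_op, pow_op. simpl Nat.iter.
    rewrite Q, <- F, L.
    rewrite (Dop_ext I _ (fun t => Dop I f t - RtoC ((INR n + 1) * a / (a * t + b)) * f t)%C)
      by (trivial; intros t _; rewrite L; ring).
    ring.
  + now apply general_solution_powers.
Qed.
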